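(* For any connected graph $G$ of order $n \geq 3$, $$\gamma_{c}(M(G)) = n-1.$$
   Context: All graphs are non-empty, finite, undirected and simple. The order of a graph is its number of vertices. A dominating set of a graph $H$ is a set $S \subseteq V(H)$ such that $N_H[v] \cap S \neq \emptyset$ for every $v \in V(H)$, where $N_H[v]$ is the closed neighborhood of $v$. A dominating set $S$ of $H$ is a connected dominating set if the induced subgraph $H[S]$ is connected. The connected domination number $\gamma_c(H)$ is the minimum cardinality of a connected dominating set of $H$. The middle graph $M(G)$ of a graph $G$ is the graph with vertex set $V(G) \cup E(G)$ (disjoint union), in which two vertices $x,y$ are adjacent if and only if either $x,y \in E(G)$ are distinct edges sharing an endpoint in $G$, or one of them is a vertex of $G$ and the other is an edge of $G$ incident with it. *)

(* Defs.v *)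
From mathcomp Require Import all_boot.

Set Implicit Arguments.
Unset Strict Implicit.
Unset Printing Implicit Defensive.

Record sgraph := SGraph {
  vertex :> finType;
  adj : rel vertex;
  adj_sym : symmetric adj;
  adj_irrefl : irreflexive adj }.

Arguments adj {G} : rename.

(* The null graph is excluded: graphs are non-empty. *)
Definition connected (G : sgraph) : bool :=
  (0 < #|G|) && [forall x : G, forall y : G, connect adj x y].

Section Induced.
Variables (G : sgraph) (S : {set G}).

Definition induced_adj : rel {x : G | x \in S} :=
  fun x y => adj (val x) (val y).

Lemma induced_adj_sym : symmetric induced_adj.
Proof. by move=> x y; apply: adj_sym. Qed.

Lemma induced_adj_irrefl : irreflexive induced_adj.
Proof. by move=> x; apply: adj_irrefl. Qed.

Definition induced : sgraph := SGraph induced_adj_sym induced_adj_irrefl.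

End Induced.

Section Domination.
Variable G : sgraph.

Definition closed_nbhd (v : G) : {set G} := v |: [set u | adj v u].

Definition dominating (S : {set G}) : bool :=
  [forall v : G, closed_nbhd v :&: S != set0].

Definition connected_dominating (S : {set G}) : bool :=
  dominating S && connected (induced S).

(* The default [set: G] is itself a connected dominating set as soon as G is
   connected, so that the minimum is then attained: see conn_dom_numberP. *)
Definition conn_dom_number : nat :=
  #|[arg min_(S < [set: G] | connected_dominating S) #|S|]|.

Lemma connected_dominatingT : connected G -> connected_dominating [set: G].
Proof.
case/andP=> G0 /forallP cG; apply/andP; split.
  by apply/forallP=> v; apply/set0Pn; exists v; rewrite !inE eqxx.
apply/andP; split.
  by rewrite card_sig; case/card_gt0P: G0 => x _; apply/card_gt0P; exists x; rewrite !inE.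
apply/forallP=> x; apply/forallP=> y.
pose f (z : G) : induced [set: G] := exist _ z (in_setT z).
have fE z : f (val z) = z by apply: val_inj.
have /forallP/(_ (val y))/connectP[p] := cG (val x).
rewrite -[x in connect _ x _]fE -[y in connect _ _ y]fE.
elim: p (val x) => [|z p IHp] u /= => [_ ->|]; first exact: connect0.
case/andP=> uz /IHp IH /IH; apply: connect_trans.
exact: connect1.
Qed.

Lemma conn_dom_numberP : connected G ->
  (exists2 S, connected_dominating S & #|S| = conn_dom_number) /\
  (forall S, connected_dominating S -> conn_dom_number <= #|S|).
Proof.
move=> /connected_dominatingT cT; rewrite /conn_dom_number.
by case: arg_minnP => // S cS minS; split=> //; exists S.
Qed.

End Domination.

Section Middle.
Variable G : sgraph.

Definition is_edge (A : {set G}) : bool :=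
  [exists x : G, exists y : G, adj x y && (A == [set x; y])].

Definition edge : finType := {A : {set G} | is_edge A}.

Definition middle_adj : rel (G + edge)%type := fun a b =>
  match a, b with
  | inl _, inl _ => false
  | inl v, inr f => v \in val f
  | inr f, inl v => v \in val f
  | inr f, inr g => (f != g) && (val f :&: val g != set0)
  end.

Lemma middle_adj_sym : symmetric middle_adj.
Proof. by case=> [v|f] [w|g] //=; rewrite eq_sym setIC. Qed.

Lemma middle_adj_irrefl : irreflexive middle_adj.
Proof. by case=> [v|f] //=; rewrite eqxx. Qed.

Definition middle : sgraph := SGraph middle_adj_sym middle_adj_irrefl.

End Middle.

(* Main.v *)
Require Import Defs.
From mathcomp Require Import all_boot.

Set Implicit Arguments.
Unset Strict Implicit.
Unset Printing Implicit Defensive.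

(** Every vertex of [M(G)] has a trace in [V(G)]: a vertex [v] leaves [{v}], an
    edge leaves its two endpoints.  In these terms [M(G)] is an intersection
    graph: distinct elements are adjacent exactly when their traces meet
    ([middle_adjE]).  Hence [S] dominates [M(G)] exactly when the traces of
    its elements cover [V(G)] ([dominating_middle]).

    Lower bound.  Build a connected set [S] one element at a time, each new
    element being adjacent to an earlier one.  Its trace has at most two points
    and meets what is already covered, so each element after the first adds at
    most one vertex; the first covers at most two.  Thus [S] covers at most
    [#|S| + 1] vertices ([card_shadow]), and a connected dominating set has at
    least [n - 1] elements.

    Upper bound.  The [n - 1] edges of a spanning tree of [G] are enough: they
    cover [V(G)], and they are connected in [M(G)] because the tree is.  The
    tree itself is never formed: starting from one edge, [G] is exhausted one
    vertex at a time, and the edge that reaches the new vertex joins the set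
    ([edge_cover]).

    Both halves rest on [connected_grow], the induction principle that builds a
    connected set by successive neighbours. *)

(** * Connected induced subgraphs *)

Lemma adj_connect_sym (G : sgraph) : connect_sym (@adj G).
Proof. exact: sym_connect_sym (@adj_sym G). Qed.

Section Connectivity.
Variable G : sgraph.
Implicit Types (S T : {set G}) (x y : G).

Lemma connected_inducedP S :
  connected (induced S) ->
  forall x y (xS : x \in S) (yS : y \in S),
    connect (@adj (induced S)) (exist _ x xS) (exist _ y yS).
Proof. by case/andP=> _ /forallP cS x y xS yS; move/forallP: (cS (exist _ x xS)). Qed.

(** Otherwise [T] would be closed under adjacency inside [S], hence a union of
    connected components of [S]. *)
Lemma connected_cut S T :
  connected (induced S) -> T \proper S -> T != set0 ->
  exists x y, [/\ x \in T, y \in S, y \notin T & adj x y].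
Proof.
move=> cS /properP[sTS [y yS yT]] /set0Pn[x xT].
have xS := subsetP sTS x xT.
have [/existsP[u /existsP[v /and4P[]]]|noE] := boolP
  [exists u, exists v, [&& u \in T, v \in S, v \notin T & adj u v]].
  by exists u, v.
have step (u v : induced S) : adj u v -> val u \in T -> val v \in T.
  move=> uv uT; apply: contraR noE => vT.
  apply/existsP; exists (val u); apply/existsP; exists (val v).
  by rewrite uT vT (valP v).
pose A := [pred z : induced S | val z \in T].
have clA : closed (@adj (induced S)) A.
  move=> u v uv; apply/idP/idP; first exact: step.
  by apply: step; rewrite adj_sym.
have := closed_connect clA (connected_inducedP cS xS yS).
by rewrite !inE /= xT (negPf yT).
Qed.

(** The starting set [T0] is arbitrary, because the count for spanning edges has
    to begin with the two ends of an edge: a single vertex has no edge to cover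
    it. *)
Lemma connected_grow S T0 (P : {set G} -> Prop) :
  connected (induced S) -> T0 \subset S -> T0 != set0 -> P T0 ->
  (forall T x y, P T -> x \in T -> y \notin T -> adj x y -> P (y |: T)) ->
  P S.
Proof.
move=> cS sT0 nT0 PT0 step.
have [k leST] := ubnP (#|S| - #|T0|).
elim: k T0 sT0 nT0 PT0 leST => // k IH T sTS nT PT leST.
have [eqTS|neTS] := eqVneq T S; first by rewrite -eqTS.
have pTS : T \proper S by rewrite properEneq neTS.
have [x [y [xT yS yT xy]]] := connected_cut cS pTS nT.
apply: (IH (y |: T)).
- by rewrite subUset sub1set yS.
- by apply/set0Pn; exists y; rewrite setU11.
- exact: step PT xT yT xy.
- by rewrite cardsU1 yT addnC subnDA subn1 -ltnS prednK // subn_gt0 proper_card.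
Qed.

Lemma connected_induced1 x : connected (induced [set x]).
Proof.
apply/andP; split.
  by rewrite card_sig; apply/card_gt0P; exists x; rewrite !inE.
apply/forallP=> u; apply/forallP=> v.
have -> : u = v by apply: val_inj; rewrite (set1P (valP u)) (set1P (valP v)).
exact: connect0.
Qed.

Lemma connect_induced_subset S T x y (xS : x \in S) (yS : y \in S)
    (xT : x \in T) (yT : y \in T) :
  S \subset T ->
  connect (@adj (induced S)) (exist _ x xS) (exist _ y yS) ->
  connect (@adj (induced T)) (exist _ x xT) (exist _ y yT).
Proof.
move=> sST /connectP[p]; elim: p x xS xT => [|[z zS] p IHp] x xS xT /=.
  by move=> _ [eq_yx]; subst y; rewrite (bool_irrelevance yT xT) connect0.
case/andP=> xz zp yE; have zT := subsetP sST z zS.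
apply: connect_trans (IHp z zS zT zp yE).
exact: connect1.
Qed.

Lemma connected_inducedU1 S x y :
  connected (induced S) -> x \in S -> adj x y -> connected (induced (y |: S)).
Proof.
move=> cS xS xy; have xU : x \in y |: S by rewrite setU1r.
apply/andP; split.
  by rewrite card_sig; apply/card_gt0P; exists x.
have from_x (u : induced (y |: S)) : connect adj (exist _ x xU : induced _) u.
  case: u => u uU; case/setU1P: (uU) => [eq_uy|uS].
    by apply: connect1; rewrite /= /induced_adj /= eq_uy.
  exact: connect_induced_subset (subsetUr _ _) (connected_inducedP cS xS uS).
apply/forallP=> u; apply/forallP=> v.
by apply: connect_trans (from_x v); rewrite adj_connect_sym from_x.
Qed.

(** The minimum defining [conn_dom_number] is only known to be attained on a
    connected graph; this gets the connectedness of [M(G)] from any one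
    connected dominating set. *)
Lemma connected_dominating_connected S :
  connected_dominating S -> connected G.
Proof.
case/andP=> /forallP dS cS.
have toS x : exists2 s, s \in S & connect adj x s.
  have /set0Pn[s] := dS x; rewrite !inE => /andP[/predU1P[->|xs] sS].
    by exists x.
  by exists s => //; exact: connect1.
have inS s t : s \in S -> t \in S -> connect (@adj G) s t.
  move=> sS tS; have /connectP[p] := connected_inducedP cS sS tS.
  elim: p s sS => [|[z zS] p IHp] s sS /= => [_ [->]|]; first exact: connect0.
  case/andP=> sz zp tE; apply: connect_trans (IHp z zS zp tE).
  exact: connect1.
apply/andP; split.
  case/andP: cS; rewrite card_sig => /card_gt0P[x _] _.
  by apply/card_gt0P; exists x.
apply/forallP=> x; apply/forallP=> y.
have [[s sS xs] [t tS yt]] := (toS x, toS y).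
apply: connect_trans xs (connect_trans (inS s t sS tS) _).
by rewrite adj_connect_sym.
Qed.

Lemma connected_inducedT : connected G -> connected (induced [set: G]).
Proof. by case/connected_dominatingT/andP. Qed.

End Connectivity.

(** * The middle graph as an intersection graph *)

Section Middle.
Variable G : sgraph.
Implicit Types (S : {set middle G}) (a b : middle G).

Definition trace a : {set G} :=
  match a with inl v => [set v] | inr e => val e end.

Definition shadow S : {set G} := \bigcup_(a in S) trace a.

Lemma is_edge_set2 (x y : G) : adj x y -> is_edge [set x; y].
Proof. by move=> xy; apply/existsP; exists x; apply/existsP; exists y; rewrite xy eqxx. Qed.

Definition edge_vertex (x y : G) (xy : adj x y) : middle G :=
  inr (exist _ [set x; y] (is_edge_set2 xy)).

Lemma trace_neq0 a : trace a != set0.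
Proof.
case: a => [v|[A /= /existsP[x /existsP[y /andP[_ /eqP->]]]]] /=.
  by apply/set0Pn; exists v; rewrite inE.
by apply/set0Pn; exists x; rewrite !inE eqxx.
Qed.

Lemma card_trace a : #|trace a| <= 2.
Proof.
case: a => [v|[A /= /existsP[x /existsP[y /andP[_ /eqP->]]]]] /=.
  by rewrite cards1.
by rewrite cards2 ltnS; case: eqP.
Qed.

Lemma middle_adjE a b : adj a b = (a != b) && (trace a :&: trace b != set0).
Proof.
have meet1 v (A : {set G}) : ([set v] :&: A != set0) = (v \in A).
  apply/set0Pn/idP => [[w /setIP[/set1P->]]//|vA].
  by exists v; rewrite !inE eqxx.
case: a b => [v|e] [w|f] //=.
- by rewrite meet1 inE; case: (eqVneq v w) => [->|_]; rewrite ?eqxx ?andbF.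
- by rewrite setIC meet1.
Qed.

Lemma shadowU1 a S : shadow (a |: S) = trace a :|: shadow S.
Proof. by rewrite /shadow bigcup_setU big_set1. Qed.

Lemma dominating_middle S : dominating S = (shadow S == setT).
Proof.
apply/forallP/eqP => [dS|covS a].
  apply/setP=> v; rewrite [RHS]inE; apply/bigcupP.
  have /set0Pn[s /setIP[vs sS]] := dS (inl v); exists s => //.
  move: vs; rewrite !inE middle_adjE => /predU1P[->|/andP[_]].
    by rewrite inE.
  by case/set0Pn=> w /setIP[/set1P->].
have /set0Pn[v va] := trace_neq0 a.
have : v \in shadow S by rewrite covS inE.
case/bigcupP=> s sS vs; apply/set0Pn; exists s.
rewrite !inE sS andbT middle_adjE eq_sym; case: eqP => //= _.
by apply/set0Pn; exists v; rewrite inE va.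
Qed.

(** Each element after the first shares a point with what is already covered,
    so it contributes at most one new vertex. *)
Lemma card_shadow S : connected (induced S) -> #|shadow S| <= #|S|.+1.
Proof.
move=> cS; have /andP[] := cS; rewrite card_sig => /card_gt0P[s sS] _.
apply: (@connected_grow _ S [set s] (fun T => #|shadow T| <= #|T|.+1) cS).
- by rewrite sub1set.
- by apply/set0Pn; exists s; rewrite inE.
- by rewrite /shadow big_set1 cards1 card_trace.
move=> T a b leT aT bT; rewrite middle_adjE => /andP[_ /set0Pn[v /setIP[va vb]]].
have vT : v \in shadow T by apply/bigcupP; exists a.
rewrite shadowU1 cardsU1 bT add1n cardsU leq_subLR.
apply: (@leq_trans (2 + #|T|.+1)); first by rewrite leq_add ?card_trace.
have : 0 < #|trace b :&: shadow T| by apply/card_gt0P; exists v; rewrite inE vb.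
by rewrite -(leq_add2r #|T|.+2); apply: leq_trans.
Qed.

(** This replaces a spanning tree.  The edge through which a new vertex is
    reached has its other end already covered, hence meets an earlier edge and
    keeps the set connected.  Bounding the size strictly by the number of
    reached vertices, rather than fixing it, makes it harmless for the new edge
    to be in the set already. *)
Lemma edge_cover :
  connected G -> 1 < #|G| ->
  exists S, [/\ connected (induced S), shadow S = setT & #|S| < #|G|].
Proof.
move=> cG; have cT := connected_inducedT cG.
rewrite -cardsT => G2.
have /card_gt0P[x0 _] := ltnW G2.
have ne1 (x : G) : [set x] != set0 by apply/set0Pn; exists x; rewrite inE.
have [|x [y [/set1P-> _ yx0 xy {x}]]] := connected_cut cT _ (ne1 x0).
  by rewrite properEcard subsetT cards1.
rewrite inE eq_sym in yx0.
suff [S [cS sTS ltS]] : exists S,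
    [/\ connected (induced S), [set: G] \subset shadow S & #|S| < #|[set: G]|].
  by exists S; split=> //; apply/eqP; rewrite eqEsubset subsetT.
apply: (@connected_grow _ _ [set x0; y] (fun T => exists S,
    [/\ connected (induced S), T \subset shadow S & #|S| < #|T|]) cT).
- exact: subsetT.
- by apply/set0Pn; exists y; rewrite !inE eqxx orbT.
- exists [set edge_vertex xy]; split; first exact: connected_induced1.
    by rewrite /shadow big_set1.
  by rewrite cards1 cards2 yx0.
move=> T x z [S [cS sTS ltS]] xT zT xz; pose e := edge_vertex xz.
exists (e |: S); split.
- have [eS|eS] := boolP (e \in S).
    by rewrite (setUidPr _) ?sub1set.
  have /bigcupP[a aS xa] := subsetP sTS x xT.
  apply: (connected_inducedU1 cS aS).
  rewrite middle_adjE (memPn eS a aS) /=.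
  by apply/set0Pn; exists x; rewrite !inE xa eqxx.
- by rewrite shadowU1 setUSS // sub1set !inE eqxx orbT.
- by rewrite !cardsU1 zT; case: (e \notin S) => //=; exact: ltnW.
Qed.

End Middle.

Theorem theorem3p1 (G : sgraph) (n : nat) (cG : connected G)
    (oG : #|G| = n) (hn : 3 <= n) :
  conn_dom_number (middle G) = n - 1.
Proof.
have [|S [cS covS ltS]] := edge_cover cG; first by rewrite oG ltnW.
have cdS : connected_dominating S.
  by rewrite /connected_dominating dominating_middle covS eqxx.
have [[D /andP[dD cD] <-] minD] :=
  conn_dom_numberP (connected_dominating_connected cdS).
rewrite subn1; apply/eqP; rewrite eqn_leq; apply/andP; split.
  apply: leq_trans (minD S cdS) _.
  by rewrite -ltnS prednK -?oG // (leq_ltn_trans _ ltS).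
have := card_shadow cD; rewrite dominating_middle in dD.
by rewrite (eqP dD) cardsT oG; case: (n).
Qed.
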